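(* Let $n$ be an odd prime number, let $\mathbb{F}_q$ be a finite field of characteristic $p$ with $n\neq p$, and let $f$ be a nontrivial multiplicative function with values in $\mathbb{F}_q$, extended by $f(0)=f(n)=0$. Then for every translation-invariant operator $A:\mathbb{F}_q^n\to\mathbb{F}_q^n$ representable in the form $A=B\Delta$ with $B$ a translation-invariant operator on $\mathbb{F}_q^n$, the function $f$ is either a most complicated or an almost most complicated function of $A$.
   Context: Vectors of $\mathbb{F}_q^n$ are columns $x=(x_1,\dots,x_n)^T$. The cyclic shift operator $\delta$ on $\mathbb{F}_q^n$ is $\delta(x_1,x_2,\dots,x_n)^T=(x_2,\dots,x_n,x_1)^T$. A linear operator $A:\mathbb{F}_q^n\to\mathbb{F}_q^n$ is called translation-invariant if $A\delta=\delta A$. The finite differentiation operator is $\Delta=\delta-I$, where $I$ is the identity operator. For $n$ prime, a function $f:\{1,\dots,n-1\}\to\mathbb{F}_q$ is called multiplicative if $f(ij \bmod n)=f(i)f(j)$ for all $i,j\in\{1,\dots,n-1\}$ and $f$ is not identically zero. It is nontrivial if it is not identically equal to $1$. For a linear operator $A$ on $\mathbb{F}_q^n$ and $x\in\mathbb{F}_q^n$, the sequence $x,Ax,A^2x,\dots$ is eventually periodic; its preperiod is the least $m\ge 0$ such that $A^m x=A^{m+t}x$ for some $t\ge 1$, and its period is the length of the cycle it eventually enters. A function $f$ with values in $\mathbb{F}_q$ is identified with the vector $x=(f(1),\dots,f(n))^T$. The function $f$ is called a most complicated function of $A$ if the sequence $x,Ax,A^2x,\dots$ has both the maximal period and the maximal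 preperiod, and an almost most complicated function of $A$ if it has the maximal period and its preperiod is exactly one less than the maximal preperiod; the maxima are taken over all starting vectors in $\mathbb{F}_q^n$ (for the given $A$). *)

(* Defs.v *)
From mathcomp Require Import all_boot all_order all_algebra.

Set Implicit Arguments.
Unset Strict Implicit.
Unset Printing Implicit Defensive.

Import GRing.Theory.
Local Open Scope ring_scope.

Section Iteration.
Variables (T : finType) (f : T -> T) (x : T).

Lemma cyclicP (y : T) :
  reflect (exists2 t, (0 < t)%N & y = iter t f y) (fconnect f (f y) y).
Proof.
apply: (iffP idP) => [/iter_findex fy | [[//|t] _ yE]].
  by exists (findex f (f y) y).+1; rewrite // iterSr fy.
by rewrite {2}yE iterSr fconnect_iter.
Qed.

Lemma preperiodic_subproof :
  exists m, fconnect f (f (iter m f x)) (iter m f x).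
Proof.
have /trajectP[m ltm fm] := looping_order f x.
exists m; apply/cyclicP; exists (order f x - m)%N; first by rewrite subn_gt0.
by rewrite -iterD subnK ?fm // ltnW.
Qed.

(* The least m with iter m f x = iter (m + t) f x for some t >= 1;
   see preperiodP. *)
Definition preperiod : nat := ex_minn preperiodic_subproof.

(* iter preperiod f x lies on the cycle, so its orbit is the whole cycle; see
   periodP. *)
Definition period : nat := order f (iter preperiod f x).

Lemma preperiodP m :
  (exists2 t, (0 < t)%N & iter m f x = iter (m + t) f x) <-> (preperiod <= m)%N.
Proof.
have step k : (exists2 t, (0 < t)%N & iter k f x = iter (k + t) f x) <->
    fconnect f (f (iter k f x)) (iter k f x).
  split=> [[t t0 e] | /cyclicP[t t0 e]]; last by exists t; rewrite // addnC iterD.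
  by apply/cyclicP; exists t; rewrite // -iterD addnC.
rewrite /preperiod; case: ex_minnP => m0 /step[t t0 e] min.
split=> [/step/min // | le]; exists t => //.
by rewrite -(subnK le) -addnA !(iterD (m - m0)) e.
Qed.

Lemma period_gt0 : (0 < period)%N.
Proof. exact: order_gt0. Qed.

Lemma periodP t :
  (exists m, iter m f x = iter (m + t) f x) <-> (period %| t)%N.
Proof.
have [k k0 kE] := (preperiodP preperiod).2 (leqnn _).
set c := iter preperiod f x.
have cyc : iter period f c = c.
  by apply/(orbitPcycle 2 4)/cyclicP; exists k; rewrite // -iterD addnC.
have cycM j : iter (j * period) f c = c.
  by elim: j => // j IHj; rewrite mulSn iterD IHj.
split=> [[m mE] | /dvdnP[j ->]]; last by exists preperiod; rewrite addnC iterD cycM.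
have ct : iter t f c = c.
  case: (posnP t) => [-> // | t0].
  have le : (preperiod <= m)%N by apply/preperiodP; exists t.
  have cmE : iter (m - preperiod) f c = iter (m - preperiod + t) f c.
    by rewrite /c -!iterD addnAC subnK.
  set d := (m - preperiod)%N in cmE.
  have dK y : iter (d * period - d) f (iter d f y) = iter (d * period) f y.
    by rewrite -iterD subnK // leq_pmulr // order_gt0.
  have := congr1 (iter (d * period - d) f) cmE.
  by rewrite iterD !dK cycM -iterD addnC iterD cycM.
have := ct; rewrite {1}(divn_eq t period) addnC iterD cycM => rE.
rewrite /dvdn -[X in X == _](@findex_iter _ f c) ?ltn_mod ?period_gt0 //.
by rewrite rE findex0.
Qed.

End Iteration.

(* Coordinate i : 'I_n of a column stands for the coordinate of index i + 1 in
   {1, ..., n}. *)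
Section Shift.
Variables (F : finFieldType) (n : nat).

Definition shift (x : 'cV[F]_n) : 'cV[F]_n := \col_i x (ordS i) 0.

Definition difference (x : 'cV[F]_n) : 'cV[F]_n := shift x - x.

Definition translation_invariant (A : {linear 'cV[F]_n -> 'cV[F]_n}) : Prop :=
  forall x, A (shift x) = shift (A x).

(* Only the values at 1, ..., n - 1 matter. *)
Definition multiplicative (f : nat -> F) : Prop :=
  (forall i j, (0 < i < n)%N -> (0 < j < n)%N -> f ((i * j) %% n)%N = f i * f j)
  /\ exists2 i, (0 < i < n)%N & f i != 0.

Definition nontrivial (f : nat -> F) : Prop :=
  exists2 i, (0 < i < n)%N & f i != 1.

Definition values (f : nat -> F) : 'cV[F]_n := \col_(i < n) f i.+1.

Definition most_complicated (A : {linear 'cV[F]_n -> 'cV[F]_n}) (f : nat -> F) :=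
  period A (values f) = (\max_(y : 'cV[F]_n) period A y)%N /\
  preperiod A (values f) = (\max_(y : 'cV[F]_n) preperiod A y)%N.

Definition almost_most_complicated
    (A : {linear 'cV[F]_n -> 'cV[F]_n}) (f : nat -> F) :=
  period A (values f) = (\max_(y : 'cV[F]_n) period A y)%N /\
  (preperiod A (values f)).+1 = (\max_(y : 'cV[F]_n) preperiod A y)%N.

End Shift.

(* Main.v *)
Require Import Defs.
From mathcomp Require Import all_boot all_order all_algebra.
From mathcomp Require Import cyclic finfield.

Set Implicit Arguments.
Unset Strict Implicit.
Unset Printing Implicit Defensive.

(** The translation-invariant operators are the polynomials in the shift
    [delta], so they commute and form the algebra F[X]/(X^n - 1), where n is
    invertible in F.  Put q = #|F|.

    Preperiods: choose d with q^d = 1 mod n.  For a polynomial P over F,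
    P(X)^(q^d) = P(X^(q^d)), and delta^(q^d) = delta; hence A^(q^d) = A for
    every translation-invariant A, and no preperiod exceeds 1
    ([polyshift_Frobenius]).  When A = B Delta the nonzero constant vectors are
    killed by A, so the maximal preperiod is exactly 1 ([max_preperiod]), and
    the preperiod of f is either the maximal one or one less.

    Periods: it remains to see that f has the maximal period.  Over an
    extension of F with a primitive n-th root of unity z, the algebra is a
    product of fields, and the period of f is maximal as soon as all its
    components other than the constant one are nonzero.  These components are
    Gauss sums sum_k f(k) z^(jk), which do not vanish.  The argument below
    avoids the extension: the classical identity that the Gauss sums of f at z
    and of 1/f at 1/z multiply to n is encoded as a correlation of f with 1/f
    ([character_correlation]), by which some polynomial in delta maps f to
    n e - (1, ..., 1)^T, where e is the last unit vector ([gauss_sum_values]).  Thus a polynomial R in delta with R f = 0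
    satisfies n R Delta e = 0, so R Delta = 0 because e generates the whole
    space under the shift ([annihilator_values]).  Applied to
    R = A^m - A^(m + t), where t is the period of f, this gives
    A^(m + 1) = A^(m + t + 1), so all periods divide t ([max_period]). *)

(** * Polynomials in the cyclic shift *)

Section ShiftAlgebra.
Import GRing.Theory.
Local Open Scope ring_scope.
Variables (F : finFieldType) (n' : nat).
Local Notation n := n'.+1.
Local Notation V := 'cV[F]_n.
Implicit Types (x y : V) (P Q : {poly F}).

Definition shift_mx : 'M[F]_n := \matrix_(i, j) (j == ordS i)%:R.

Definition polyshift (P : {poly F}) : 'M[F]_n := horner_mx shift_mx P.

Lemma mul_shift_mx x : shift_mx *m x = shift x.
Proof.
apply/colP=> i; rewrite !mxE (bigD1 (ordS i)) //= !mxE eqxx mul1r big1 ?addr0 //.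
by move=> j /negPf jE; rewrite mxE jE mul0r.
Qed.

Lemma polyshiftM P Q x :
  polyshift (P * Q) *m x = polyshift P *m (polyshift Q *m x).
Proof. by rewrite mulmxA /polyshift rmorphM. Qed.

Lemma polyshiftB P Q x :
  polyshift (P - Q) *m x = polyshift P *m x - polyshift Q *m x.
Proof. by rewrite /polyshift rmorphB mulmxBl. Qed.

Lemma polyshift_exp P m x :
  polyshift (P ^+ m) *m x = iter m (mulmx (polyshift P)) x.
Proof.
elim: m => [|m IHm]; first by rewrite expr0 /polyshift rmorph1 mul1mx.
by rewrite exprS polyshiftM IHm.
Qed.

Lemma polyshiftX x : polyshift 'X *m x = shift x.
Proof. by rewrite /polyshift horner_mx_X mul_shift_mx. Qed.

Lemma polyshift_sum (I : finType) (A : pred I) (c : I -> F) (m : I -> nat) :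
  polyshift (\sum_(i | A i) c i *: 'X^(m i)) =
  \sum_(i | A i) c i *: polyshift 'X^(m i).
Proof.
by rewrite /polyshift raddf_sum; apply: eq_bigr => i _; apply: horner_mxZ.
Qed.

Lemma polyshift_difference x : polyshift ('X - 1) *m x = difference x.
Proof.
by rewrite polyshiftB polyshiftX /polyshift rmorph1 mul1mx.
Qed.

Lemma polyshiftXn m x : polyshift 'X^m *m x = iter m (@shift F n) x.
Proof. by rewrite polyshift_exp; apply: eq_iter => y; rewrite polyshiftX. Qed.

Lemma iter_shiftE m x i : iter m (@shift F n) x i 0 = x (inZp (i + m)) 0.
Proof.
elim: m i => [|m IHm] i /=; first by rewrite addn0 valZpK.
rewrite mxE IHm; congr (x _ _); apply: val_inj => /=.
by rewrite modnDml addSnnS.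
Qed.

(** Since the shift decreases indices, its powers delta^0, ..., delta^(n - 1)
    send the last unit vector to all the unit vectors, without wrap-around.
    Below this vector is called e. *)
Definition cyclic_vector : V := delta_mx ord_max 0.

Lemma polyshiftXn_cyclic_vector (i : 'I_n) :
  polyshift 'X^(n' - i) *m cyclic_vector = delta_mx i 0.
Proof.
rewrite polyshiftXn; apply/colP=> j; rewrite iter_shiftE !mxE !andbT.
congr (_ %:R); congr nat_of_bool; apply/eqP/eqP=> [/(congr1 val)/= jE | ->].
  apply: val_inj => /=; have := ltn_ord i; rewrite ltnS => le_in.
  have : j + n' = i + n' %[mod n].
    have -> : (j + n' = j + (n' - i) + i)%N by rewrite -addnA subnK.
    by rewrite -modnDml jE addnC.
  move/eqP; rewrite eqn_modDr => /eqP.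
  by rewrite !modn_small.
apply: val_inj => /=; rewrite subnKC ?modn_small //.
by rewrite -ltnS.
Qed.

Definition coord_poly x : {poly F} := \sum_(i < n) x i 0 *: 'X^(n' - i).

Lemma polyshift_coord_poly x : polyshift (coord_poly x) *m cyclic_vector = x.
Proof.
rewrite [in RHS](matrix_sum_delta x) polyshift_sum mulmx_suml.
apply: eq_bigr => i _; rewrite big_ord1.
by rewrite -scalemxAl polyshiftXn_cyclic_vector.
Qed.

(** Every vector is Q e for a polynomial Q in the shift, and P Q e = Q P e. *)
Lemma polyshift_eq0_cyclic P :
  polyshift P *m cyclic_vector = 0 -> forall x, polyshift P *m x = 0.
Proof.
move=> P0 x; rewrite -(polyshift_coord_poly x) -polyshiftM mulrC polyshiftM.
by rewrite P0 mulmx0.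
Qed.

(** B commutes with polynomials in the shift, so it is determined by B e, and
    the polynomial carrying e to B e does the same. *)
Lemma translation_invariant_polyshift (B : {linear V -> V}) :
  translation_invariant B -> exists P, forall x, B x = polyshift P *m x.
Proof.
move=> B_ti.
have BXn m x : B (polyshift 'X^m *m x) = polyshift 'X^m *m B x.
  by rewrite !polyshiftXn; elim: m => //= m <-; rewrite B_ti.
have BP P x : B (polyshift P *m x) = polyshift P *m B x.
  rewrite -(coefK P) poly_def polyshift_sum !mulmx_suml raddf_sum.
  by apply: eq_bigr => i _; rewrite /= -!scalemxAl linearZ BXn.
exists (coord_poly (B cyclic_vector)) => x.
rewrite -{1}(polyshift_coord_poly x) BP.
rewrite -{1}(polyshift_coord_poly (B _)) -polyshiftM mulrC polyshiftM.
by rewrite polyshift_coord_poly.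
Qed.

Lemma shift_mx_exp_size : shift_mx ^+ n = 1.
Proof.
have polyX m : shift_mx ^+ m = polyshift 'X^m.
  by rewrite /polyshift rmorphXn /= horner_mx_X.
rewrite polyX; apply/matrixP=> i j.
have -> : polyshift 'X^n i j = (polyshift 'X^n *m delta_mx j (0 : 'I_1)) i 0.
  by rewrite -colE mxE.
rewrite polyshiftXn iter_shiftE !mxE andbT; congr (_ == _)%:R.
by apply: val_inj => /=; rewrite modnDr modn_small.
Qed.

Lemma expf_card_exp (c : F) d : c ^+ (#|F| ^ d) = c.
Proof.
by elim: d => [|d IHd]; rewrite ?expr1 // expnSr exprM IHd expf_card.
Qed.

(** The Frobenius power of a polynomial fixes its coefficients and multiplies
    its exponents by #|F|^d, which changes nothing when delta^n = 1. *)
Lemma polyshift_Frobenius d P :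
  #|F| ^ d = 1 %[mod n] -> polyshift (P ^+ (#|F| ^ d)) = polyshift P.
Proof.
have [p p_pr charF] := finPcharP F.
set q := (_ ^ d)%N => q1.
(* q is a power of the characteristic, so q-th powers are additive. *)
have pq : [pchar {poly F}].-nat q.
  rewrite (eq_pnat _ (pchar_poly _)) (eq_pnat _ (pcharf_eq charF)).
  by rewrite pnatX -[#|F|]/#|pPrimeCharType charF| card_pprimeChar pnatX pnat_id.
have Sq : shift_mx ^+ q = shift_mx.
  have q0 : (0 < q)%N by rewrite expn_gt0 ltnW ?finNzRing_gt1.
  rewrite -(prednK q0) exprS.
  have /dvdnP[k ->] : (n %| q.-1)%N.
    by rewrite -subn1 -(eqn_mod_dvd _ q0); apply/eqP.
  by rewrite mulnC exprM shift_mx_exp_size expr1n mulr1.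
have powD : {morph (fun Q => Q ^+ q) : Q R / Q + R}.
  by move=> Q R; apply: exprDn_pchar.
have pow0 : (0 : {poly F}) ^+ q = 0.
  by rewrite expr0n; case: (q) pq.
rewrite -{1}(coefK P) poly_def (big_morph _ powD pow0).
under eq_bigr => i _ do rewrite exprZn expf_card_exp -exprM.
rewrite polyshift_sum -[in RHS](coefK P) poly_def polyshift_sum.
apply: eq_bigr => i _; rewrite mulnC exprM /polyshift !rmorphXn /=.
by rewrite horner_mx_X Sq.
Qed.

End ShiftAlgebra.

(** * The Gauss sum of a multiplicative function *)

Section GaussSum.
Import GRing.Theory.
Local Open Scope ring_scope.
Variables (n : nat) (F : fieldType) (chi : 'F_n -> F).
Hypothesis n_pr : prime n.
Hypotheses (chiM : {morph chi : a b / a * b}) (chi1 : chi 1 = 1).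
Hypothesis chi_nontriv : exists2 a, a != 0 & chi a != 1.

(** Multiplying the index by some a with chi a <> 1 permutes the sum while
    scaling it by chi a. *)
Lemma sum_character : \sum_a chi a = 0.
Proof.
have [a a0 chia] := chi_nontriv.
have : chi a * \sum_b chi b = \sum_b chi b.
  rewrite mulr_sumr [RHS](reindex_inj (mulfI a0)).
  by apply: eq_bigr => b _; rewrite chiM.
move/eqP; rewrite -subr_eq0 -{2}[\sum_b _]mul1r -mulrBl mulf_eq0 subr_eq0.
by rewrite (negPf chia) => /eqP.
Qed.

(** The terms are chi (a / b + 1).  For a = 0 each of the n - 1 terms is 1; for
    a <> 0, a / b + 1 runs over everything but 1, and the full sum vanishes.
    This is the coordinate form of the product formula for Gauss sums. *)
Lemma character_correlation (a : 'F_n) :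
  \sum_(b | b != 0) (chi b)^-1 * chi (a + b) = n%:R * (a == 0)%:R - 1.
Proof.
have chi_neq0 b : b != 0 -> chi b != 0.
  move=> b0; apply: contra_neq (oner_neq0 F) => chib0.
  by rewrite -chi1 -(mulfV b0) chiM chib0 mul0r.
have chiV b : b != 0 -> (chi b)^-1 = chi b^-1.
  by move=> b0; rewrite -[LHS]mulr1 -chi1 -(mulfV b0) chiM mulKf ?chi_neq0.
rewrite (eq_bigr (fun b => chi (a / b + 1))) => [|b b0]; last first.
  by rewrite chiV // -chiM mulrDr mulVf // mulrC.
have [-> | a0] := eqVneq a 0.
  rewrite (eq_bigr (fun=> 1)) => [|b _]; last by rewrite mul0r add0r.
  rewrite (sumr_const (predC1 (0 : 'F_n))) cardC1 card_Fp // mulr1.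
  by rewrite -subn1 natrB ?prime_gt0.
pose dv b : 'F_n := a / b.
have dvK : involutive dv by move=> b; rewrite /dv invf_div mulrCA mulfV ?mulr1.
rewrite (reindex_inj (inv_inj dvK)) mulr0 add0r.
rewrite (eq_big (fun b => b != 0) (fun b => chi (b + 1))) => [|b|b _]; last first.
- by rewrite -[_ / _]/(dv (dv b)) dvK.
- by rewrite mulf_eq0 invr_eq0 (negPf a0).
have := sum_character; rewrite (reindex_inj (addIr 1)) (bigD1 (0 : 'F_n)) //=.
by rewrite add0r chi1 => /eqP; rewrite addrC addr_eq0 => /eqP.
Qed.

End GaussSum.

(** * The shift orbit of a multiplicative function *)

Section MultiplicativeValues.
Import GRing.Theory.
Local Open Scope ring_scope.
Variables (F : finFieldType) (n' : nat).
Local Notation n := n'.+1.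
Local Notation e := (cyclic_vector F n').
Variable f : nat -> F.
Hypothesis n_pr : prime n.
Hypotheses (f_mult : Defs.multiplicative n f) (f_nontriv : nontrivial n f).
Hypotheses (f0 : f 0%N = 0) (fn : f n = 0).

Lemma multiplicative1 : f 1%N = 1.
Proof.
have [fM [i i_n fi]] := f_mult.
apply: (mulfI fi); rewrite mulr1 -fM ?prime_gt1 //.
by rewrite muln1 modn_small //; case/andP: i_n.
Qed.

(** The conditions f 0 = f n = 0 make f a function on residues modulo n. *)
Let chi (a : 'F_n) : F := f a.

Let chi_nat m : chi m%:R = f (m %% n).
Proof. by rewrite /chi val_Fp_nat. Qed.

Let chiM : {morph chi : a b / a * b}.
Proof.
move=> a b; rewrite -{1}[a]natr_Zp -{1}[b]natr_Zp -natrM chi_nat /chi.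
have lt_n (c : 'F_n) : (c < n)%N by rewrite -[X in (_ < X)%N](Fp_cast n_pr).
have [-> | a0] := eqVneq (a : nat) 0%N; first by rewrite mul0n mod0n f0 mul0r.
have [-> | b0] := eqVneq (b : nat) 0%N; first by rewrite muln0 mod0n f0 mulr0.
by rewrite f_mult.1 ?lt0n ?a0 ?b0 ?lt_n.
Qed.

Let chi1 : chi 1 = 1.
Proof. by rewrite -[1]/(1%:R) chi_nat modn_small ?prime_gt1 ?multiplicative1. Qed.

Let chi_nontriv : exists2 a, a != 0 & chi a != 1.
Proof.
have [i /andP[i0 i_n] fi] := f_nontriv.
exists i%:R; last by rewrite chi_nat modn_small.
apply/eqP=> /(congr1 val); rewrite /= val_Fp_nat // modn_small // => i_0.
by rewrite i_0 in i0.
Qed.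

(** When i + l + 1 is divisible by n, the coordinate reached by the shift holds
    f n and the right-hand side is f 0; both vanish. *)
Let values_chi l i :
  (polyshift n' 'X^l *m values n f) i 0 = chi (i.+1%:R + l%:R).
Proof.
rewrite polyshiftXn iter_shiftE mxE /= -natrD chi_nat.
have -> : ((i.+1 + l) %% n = ((i + l) %% n).+1 %% n)%N.
  by rewrite addSn -[in LHS]addn1 -modnDml addn1.
have := ltn_pmod (i + l) (ltn0Sn n').
rewrite leq_eqVlt => /predU1P[-> | lt_n]; first by rewrite fn modnn f0.
by rewrite (modn_small lt_n).
Qed.

(** This plays the role of the nonvanishing of the Gauss sums: modulo constant
    vectors, a polynomial in the shift recovers the cyclic vector from f, up to
    the invertible factor n. *)
Lemma gauss_sum_values :
  exists G, polyshift n' G *m values n f = n%:R *: e - const_mx 1.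
Proof.
exists (\sum_(b : 'F_n | b != 0) (chi b)^-1 *: 'X^b).
rewrite polyshift_sum mulmx_suml; apply/colP=> i; rewrite summxE.
under eq_bigr => b _ do rewrite -scalemxAl mxE values_chi natr_Zp.
rewrite character_correlation // !mxE andbT; congr (_ * (_)%:R - _).
rewrite -(dvdn_pcharf (pchar_Fp n_pr)).
have [-> | i_max] := eqVneq i ord_max; first by rewrite dvdnn.
rewrite gtnNdvd // ltn_neqAle ltn_ord andbT.
by apply: contra_neq i_max => -[iE]; apply: val_inj.
Qed.

End MultiplicativeValues.

(** * Maximal preperiod and period *)

Lemma iter_polyshift (F : finFieldType) n' (A : 'cV[F]_n'.+1 -> 'cV[F]_n'.+1)
    (P : {poly F}) :
  (forall x, A x = polyshift n' P *m x)%R ->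
  forall m x, (iter m A x = polyshift n' (P ^+ m) *m x)%R.
Proof. by move=> AE m x; rewrite polyshift_exp; apply: eq_iter. Qed.

Section MaximalPeriod.
Import GRing.Theory.
Local Open Scope ring_scope.
Variables (F : finFieldType) (n' : nat).
Local Notation n := n'.+1.
Local Notation V := 'cV[F]_n.
Variables (p : nat) (f : nat -> F) (A B : {linear V -> V}).
Hypotheses (n_pr : prime n) (charF : p \in [pchar F]) (n_neq_p : n <> p).
Hypotheses (f_mult : Defs.multiplicative n f) (f_nontriv : nontrivial n f).
Hypotheses (f0 : f 0%N = 0) (fn : f n = 0).
Hypotheses (B_ti : translation_invariant B) (AE : forall x, A x = B (difference x)).

Lemma factor_polyshift : exists P, forall x, A x = polyshift n' (P * ('X - 1)) *m x.
Proof.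
have [P BE] := translation_invariant_polyshift B_ti.
by exists P => x; rewrite AE BE polyshiftM polyshift_difference.
Qed.

Lemma difference_const : difference (const_mx 1 : V) = 0.
Proof. by apply/colP=> i; rewrite !mxE subrr. Qed.

Lemma coprime_card_size : coprime #|F| n.
Proof.
have p_pr := pcharf_prime charF.
rewrite -[#|F|]/#|pPrimeCharType charF| card_pprimeChar coprime_pexpl.
  by rewrite prime_coprime // dvdn_prime2 // eq_sym; apply/eqP.
rewrite lt0n; apply: contraTneq (finNzRing_gt1 F) => k0.
by rewrite -[#|F|]/#|pPrimeCharType charF| card_pprimeChar k0.
Qed.

Lemma size_natr_neq0 : n%:R != 0 :> F.
Proof.
rewrite -(dvdn_pcharf charF) dvdn_prime2 ?(pcharf_prime charF) // eq_sym.
exact/eqP.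
Qed.

(** The difference operator removes the constant vector that [gauss_sum_values]
    leaves, so R Delta kills the cyclic vector. *)
Lemma annihilator_values R :
  polyshift n' R *m values n f = 0 ->
  forall x : V, polyshift n' (R * ('X - 1)) *m x = 0.
Proof.
move=> Rf; apply: polyshift_eq0_cyclic; set e := cyclic_vector _ _.
have [G GE] := gauss_sum_values n_pr f_mult f_nontriv f0 fn.
have : polyshift n' (R * ('X - 1)) *m (n%:R *: e - const_mx 1) = 0.
  by rewrite -GE -polyshiftM -mulrA mulrC polyshiftM Rf mulmx0.
rewrite mulmxBr -scalemxAr [X in _ - X]polyshiftM polyshift_difference.
rewrite difference_const mulmx0 subr0 => /eqP.
by rewrite scaler_eq0 (negPf size_natr_neq0) => /eqP.
Qed.

(** The upper bound is A^(#|F|^d) = A with d = totient n; the value 1 is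
    attained at a constant vector, which A sends to 0. *)
Lemma max_preperiod : (\max_(y : V) preperiod A y)%N = 1%N.
Proof.
have [P AP] := factor_polyshift.
have iterA := iter_polyshift AP.
apply/eqP; rewrite eqn_leq; apply/andP; split.
  apply/bigmax_leqP=> y _; apply/preperiodP.
  set q := (#|F| ^ totient n)%N.
  have q_gt1 : (1 < q)%N.
    by rewrite -(exp1n (totient n)) ltn_exp2r ?finNzRing_gt1 ?totient_gt0.
  exists q.-1; first by rewrite -ltnS prednK ?(ltnW q_gt1).
  rewrite add1n prednK ?(ltnW q_gt1) // !iterA expr1 polyshift_Frobenius //.
  exact/Euler_exp_totient/coprime_card_size.
apply: leq_trans (leq_bigmax (const_mx 1 : V)).
rewrite lt0n; apply/negP => /eqP pre0.
have /preperiodP[[|t] // _] : (preperiod A (const_mx 1%R : V) <= 0)%N by rewrite pre0.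
rewrite add0n iterSr AE difference_const linear0 [in RHS]iterA mulmx0 /= => /colP/(_ ord0).
by rewrite !mxE => /eqP; rewrite oner_eq0.
Qed.

(** If t is the period of f, then A^m - A^(m + t) kills f for some m; one more
    factor A = P Delta makes it vanish identically. *)
Lemma max_period : period A (values n f) = (\max_(y : V) period A y)%N.
Proof.
have [P AP] := factor_polyshift.
have iterA := iter_polyshift AP.
apply/eqP; rewrite eqn_leq leq_bigmax; apply/bigmax_leqP=> y _.
apply: dvdn_leq; first exact: period_gt0.
set t := period A (values n f); have [m] := (periodP A (values n f) t).2 (dvdnn _).
rewrite !iterA => /eqP; rewrite -subr_eq0 -polyshiftB => /eqP.
move/annihilator_values => R0.
apply/periodP; exists m.+1; rewrite !iterA; apply/eqP.
rewrite -subr_eq0 -polyshiftB addSn !exprSr -mulrBl.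
by rewrite mulrCA polyshiftM R0 mulmx0.
Qed.

End MaximalPeriod.

Theorem theorem2 (n p : nat) (F : finFieldType) (f : nat -> F)
    (n_prime : prime n) (n_odd : odd n)
    (charF : p \in [pchar F]%R) (n_neq_p : n <> p)
    (f_mult : multiplicative n f) (f_nontriv : nontrivial n f)
    (f0 : f 0 = 0%R) (fn : f n = 0%R)
    (A B : {linear 'cV[F]_n -> 'cV[F]_n})
    (A_ti : translation_invariant A) (B_ti : translation_invariant B)
    (A_eq : forall x, A x = B (difference x)) :
  most_complicated A f \/ almost_most_complicated A f.
Proof.
case: n => [|n'] // in n_prime n_odd n_neq_p f_mult f_nontriv fn A B A_ti B_ti A_eq *.
have per := max_period n_prime charF n_neq_p f_mult f_nontriv f0 fn B_ti A_eq.
have pre := max_preperiod n_prime charF n_neq_p B_ti A_eq.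
have : (preperiod A (values n'.+1 f) <= 1)%N by rewrite -[X in (_ <= X)%N]pre leq_bigmax.
by rewrite leq_eqVlt ltnS leqn0 => /predU1P[pre1 | /eqP pre0]; [left | right];
  split; rewrite // pre ?pre1 ?pre0.
Qed.
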